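(* If $R$ is a finite $5$-centralizer ring, then $\Pr(R) = \frac{11}{27}$.
   Context: Rings are associative; no identity element is assumed. For a finite ring $R$ and $x \in R$, the centralizer of $x$ is $C_R(x) = \{s \in R : xs = sx\}$. Put $\operatorname{Cent}(R) = \{C_R(x) : x \in R\}$; $R$ is called $n$-centralizer if $|\operatorname{Cent}(R)| = n$. The commuting probability of $R$ is $\Pr(R) = \frac{|\{(r,s) \in R \times R : rs = sr\}|}{|R|^2}$. *)

(* Defs.v *)
From mathcomp Require Import all_boot all_order all_algebra.

Set Implicit Arguments.
Unset Strict Implicit.
Unset Printing Implicit Defensive.

Import GRing.Theory.
Local Open Scope ring_scope.

(* MathComp's ring structures all contain an identity element, whereas the
   rings considered here need not have one.  A ring is therefore given as an
   additive group together with a multiplication satisfying [is_rng]. *)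
Record is_rng (R : zmodType) (mul : R -> R -> R) : Prop := IsRng {
  rng_mulA : associative mul;
  rng_mulDl : left_distributive mul +%R;
  rng_mulDr : right_distributive mul +%R
}.

Definition centralizer (R : finZmodType) (mul : R -> R -> R) (x : R) : {set R} :=
  [set s : R | mul x s == mul s x].

Definition Cent (R : finZmodType) (mul : R -> R -> R) : {set {set R}} :=
  [set centralizer mul x | x : R].

Definition n_centralizer (n : nat) (R : finZmodType) (mul : R -> R -> R) : Prop :=
  #|Cent mul| = n.

Definition commuting_probability (R : finZmodType) (mul : R -> R -> R) : rat :=
  #|[set p : R * R | mul p.1 p.2 == mul p.2 p.1]|%:R / (#|R|%:R ^+ 2).

(* Main.v *)
Require Import Defs.
From mathcomp Require Import all_boot all_order all_algebra.

(** The additive commutator [x, y] = xy - yx is biadditive and alternating, and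
R has exactly four classes of noncentral elements with a common centralizer.
Given representatives of these classes, every element commutes with some
representative, and an element commuting with all of them is central.  Testing
this on small combinations of the representatives excludes the case where all
commutators have order 2.  If c = [x, y] has 2c <> 0, the representatives can be
taken to be x, y, x + y, x - y; then x + 2y forces 3c = 0, and every element is
ix + jy modulo the center Z.  So R/Z is elementary abelian of order 9, carrying
the determinant form, and 33 of its 81 pairs commute. *)

Set Implicit Arguments.
Unset Strict Implicit.
Unset Printing Implicit Defensive.

Import GRing.Theory Num.Theory.
Local Open Scope ring_scope.

(** * Calculus of the additive commutator *)

Section Commutator.
Variables (R : finZmodType) (mul : R -> R -> R).
Hypothesis rngR : is_rng mul.

Definition commutator (x y : R) : R := mul x y - mul y x.
Local Notation "[~ x , y ]" := (commutator x y).
Local Notation C := (centralizer mul).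

(** Boolean, so that the center becomes a finite type [Z] whose elements can be counted. *)
Definition central (z : R) := [forall t, [~ z, t] == 0].

Lemma commDl x y z : [~ x + y, z] = [~ x, z] + [~ y, z].
Proof.
by rewrite /commutator (rng_mulDl rngR) (rng_mulDr rngR) opprD addrACA.
Qed.

Lemma commC x y : [~ x, y] = - [~ y, x].
Proof. by rewrite /commutator opprB. Qed.

Lemma commDr x y z : [~ x, y + z] = [~ x, y] + [~ x, z].
Proof. by rewrite commC commDl opprD -!commC. Qed.

Lemma commxx x : [~ x, x] = 0.
Proof. exact: subrr. Qed.

Lemma comm0l x : [~ 0, x] = 0.
Proof. by apply: (addrI [~ 0, x]); rewrite -commDl !addr0. Qed.

Lemma commNl x y : [~ - x, y] = - [~ x, y].
Proof. by apply: (addrI [~ x, y]); rewrite -commDl !subrr comm0l. Qed.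

Lemma commNr x y : [~ x, - y] = - [~ x, y].
Proof. by rewrite commC commNl -commC. Qed.

Lemma commMnl x y n : [~ x *+ n, y] = [~ x, y] *+ n.
Proof. by elim: n => [|n IHn]; rewrite ?comm0l // !mulrS commDl IHn. Qed.

Lemma commMnr x y n : [~ x, y *+ n] = [~ x, y] *+ n.
Proof. by rewrite commC commMnl -mulNrn -commC. Qed.

Lemma comm_eq0C x y : ([~ x, y] == 0) = ([~ y, x] == 0).
Proof. by rewrite commC oppr_eq0. Qed.

Lemma in_centralizer x y : (y \in C x) = ([~ x, y] == 0).
Proof. by rewrite inE subr_eq0. Qed.

Lemma centralP z : reflect (forall t, [~ z, t] = 0) (central z).
Proof. by apply: (iffP forallP) => h t; apply/eqP/h. Qed.

Lemma centralizer_setT z : (C z == setT) = central z.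
Proof.
apply/eqP/centralP => [Cz t | zC].
  by apply/eqP; rewrite -in_centralizer Cz inE.
by apply/setP => t; rewrite in_centralizer zC eqxx inE.
Qed.

Lemma centralizer_neq x y : [~ x, y] != 0 -> C x != C y.
Proof.
apply: contraNneq => Cxy; by rewrite -in_centralizer Cxy in_centralizer commxx.
Qed.

Lemma centralizer_eq x y : central (x - y) -> C x = C y.
Proof.
move=> /centralP xy; apply/setP => t; rewrite !in_centralizer.
by rewrite -{1}(subrK y x) commDl xy add0r.
Qed.

Lemma noncentral x y : [~ x, y] != 0 -> ~~ central x.
Proof. by apply: contraNN => /centralP ->. Qed.

(** * Representatives of the four proper centralizers *)

Hypothesis cent5 : n_centralizer 5 mul.

Lemma setT_in_Cent : setT \in Cent mul.
Proof.
apply/imsetP; exists 0 => //; apply/esym/eqP.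
by rewrite centralizer_setT; apply/centralP => t; exact: comm0l.
Qed.

Lemma exists_other_centralizer (s : seq R) :
  (size s <= 3)%N -> exists2 d, ~~ central d & C d \notin map C s.
Proof.
move=> s3; have: ~~ (Cent mul \subset setT :: map C s).
  apply/negP => /subset_leq_card; rewrite cent5 => le5.
  have := leq_trans le5 (card_size _).
  by rewrite /= size_map ltnS ltnNge s3.
case/subsetPn => _ /imsetP[d _ ->]; rewrite inE negb_or centralizer_setT.
by case/andP=> ? ?; exists d.
Qed.

(** By counting: [setT] and four distinct proper centralizers already fill the five places in
    [Cent mul]. *)
Lemma centralizer_cases (s : seq R) (w : R) :
    size s = 4 -> uniq (map C s) -> all (fun u => ~~ central u) s ->
  central w || (C w \in map C s).
Proof.
move=> s4 uniq_s /allP ncs.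
have uniqT : uniq (setT :: map C s).
  rewrite /= uniq_s andbT; apply/mapP => -[u us] /esym/eqP.
  by rewrite centralizer_setT (negbTE (ncs u us)).
have sub : {subset setT :: map C s <= enum (Cent mul)}.
  move=> A; rewrite mem_enum inE => /predU1P[->|/mapP[u _ ->]].
    exact: setT_in_Cent.
  exact: imset_f.
have [|_ eqs] := uniq_min_size uniqT sub.
  by rewrite -cardE cent5 /= size_map s4.
by have := eqs (C w); rewrite mem_enum imset_f // inE centralizer_setT => ->.
Qed.

Section FourRepresentatives.
Variable s : seq R.
Hypotheses (uniq_s : uniq (map C s)) (ncs : all (fun u => ~~ central u) s).
Hypothesis s4 : size s = 4.

(** A noncentral [w] lies in its own centralizer, which is that of some member of [s]. *)
Lemma comm_some_rep w : has (fun u => [~ w, u] == 0) s.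
Proof.
case/orP: (centralizer_cases w s4 uniq_s ncs) => [/centralP cw|].
  by case: s s4 => // u s' _; rewrite /= cw eqxx.
case/mapP=> u us Cwu; apply/hasP; exists u => //.
by rewrite -in_centralizer Cwu in_centralizer commxx.
Qed.

(** The centralizer of a noncentral [t] is that of some [u] in [s], so it contains [w] as soon as
    [w] commutes with [u]. *)
Lemma comm_all_reps_central w : all (fun u => [~ w, u] == 0) s -> central w.
Proof.
move=> /allP ws; apply/centralP => t.
case/orP: (centralizer_cases t s4 uniq_s ncs) => [/centralP ct|].
  by rewrite commC ct oppr0.
case/mapP=> u us Ctu; apply/eqP.
by rewrite comm_eq0C -in_centralizer Ctu in_centralizer comm_eq0C ws.
Qed.

End FourRepresentatives.

Lemma noncommuting_reps x y u v :
    [~ x, y] != 0 -> [~ x, u] != 0 -> [~ x, v] != 0 ->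
    [~ y, u] != 0 -> [~ y, v] != 0 -> [~ u, v] != 0 ->
  uniq (map C [:: x; y; u; v]) /\ all (fun w => ~~ central w) [:: x; y; u; v].
Proof.
move=> xy xu xv yu yv uv; split; rewrite /= ?inE ?negb_or.
  by rewrite !centralizer_neq.
rewrite (noncentral xy) (noncentral yu) (noncentral uv) /= andbT.
by apply: (@noncentral _ x); rewrite comm_eq0C.
Qed.

(** * Commutators cannot all have order dividing 2 *)

Section TwoTorsion.
Hypothesis comm2 : forall x y, [~ x, y] *+ 2 = 0.

Lemma commN2 x y : - [~ x, y] = [~ x, y].
Proof. by apply/esym/eqP; rewrite -addr_eq0 -mulr2n comm2. Qed.

Lemma commC2 x y : [~ x, y] = [~ y, x].
Proof. by rewrite commC commN2. Qed.

(** The elements [d], [x], [y], [u] represent the four classes, and tests on [d + x] and [d + y]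
    then put [d] in the class of [y]. The hypothesis on [u], weaker than [u = x + y], lets the lemma
    apply to permuted triples. *)
Lemma two_torsion_partial x y u d :
    (forall w, [~ w, u] = [~ w, x] + [~ w, y]) -> [~ x, y] != 0 ->
    ~~ central d -> C d \notin map C [:: x; y; u] -> [~ d, y] = 0 -> False.
Proof.
move=> hu xy ncd dxyu dy.
have xu : [~ x, u] = [~ x, y] by rewrite hu commxx add0r.
have yu : [~ y, u] = [~ x, y] by rewrite hu commxx addr0 commC2.
have du : [~ d, u] = [~ d, x] by rewrite hu dy addr0.
have Us : uniq (map C [:: d; x; y; u]).
  rewrite map_cons cons_uniq dxyu /= !inE negb_or.
  by rewrite !centralizer_neq ?xu ?yu.
have Ns : all (fun w => ~~ central w) [:: d; x; y; u].
  rewrite /= ncd (noncentral xy) (@noncentral y u) ?yu //=.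
  by rewrite (@noncentral u y) // comm_eq0C yu.
have cs := comm_some_rep Us Ns erefl.
have ca := comm_all_reps_central Us Ns erefl.
have dx : [~ d, x] != 0.
  apply: contraNneq ncd => dx; apply: ca.
  by rewrite /= commxx dx dy du dx eqxx.
have dxE : [~ d, x] = [~ x, y].
  have := cs (d + x); rewrite /= orbF => /or4P[]; rewrite commDl.
  - by rewrite commxx add0r commC2 (negbTE dx).
  - by rewrite commxx addr0 (negbTE dx).
  - by rewrite dy add0r (negbTE xy).
  - by rewrite du xu addr_eq0 commN2 => /eqP.
have dyc : central (d + y).
  apply: ca; rewrite /= !commDl !commxx dy du yu dxE (commC2 y x) (commC2 y d).
  by rewrite dy !addr0 -mulr2n comm2 eqxx.
move: dxyu; rewrite !inE (@centralizer_eq d y) ?eqxx ?orbT //.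
apply/centralP => t; move/centralP/(_ t): dyc.
by rewrite !commDl commNl commN2.
Qed.

Lemma two_torsion_absurd : False.
Proof.
have [x /forallPn[y xy] _] := @exists_other_centralizer [::] isT.
set u := x + y.
have [d ncd dxyu] := @exists_other_centralizer [:: x; y; u] isT.
have xu : [~ x, u] = [~ x, y] by rewrite commDr commxx add0r.
have yu : [~ y, u] = [~ x, y] by rewrite commDr commxx addr0 commC2.
(* When doubled commutators vanish, each of [x], [y], [u] has the same commutators as the sum of the
   other two, so one lemma rules out all three ways for [d] to commute with one of them. *)
have dy : [~ d, y] != 0.
  apply/eqP => dy; apply: (two_torsion_partial _ xy ncd dxyu dy) => w.
  exact: commDr.
have dx : [~ d, x] != 0.
  apply/eqP => dx; apply: (@two_torsion_partial y x u d) => //.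
  - by move=> w; rewrite commDr addrC.
  - by rewrite comm_eq0C.
  - by move: dxyu; rewrite !inE !negb_or => /and3P[-> -> ->].
have du : [~ d, u] != 0.
  apply/eqP => du; apply: (@two_torsion_partial x u y d) => //.
  - by move=> w; rewrite commDr addrA -mulr2n comm2 add0r.
  - by rewrite xu.
  - by move: dxyu; rewrite !inE !negb_or => /and3P[-> -> ->].
have [|||||| Us Ns] := @noncommuting_reps d x y u; rewrite ?xu ?yu //.
have cs := comm_some_rep Us Ns erefl.
have dxy : [~ d, x] != [~ d, y] by rewrite -(commN2 d y) -addr_eq0 -commDr.
(* Commuting with [d] or with [u] would give [[~ d, u] = 0]. In the two other cases [d + x],
   respectively [d + y], commutes with no representative. *)
have := cs (d + x + y); rewrite /= orbF => /or4P[] /eqP.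
- rewrite !commDl commxx add0r -commDl commC2 -/u => /eqP; exact/negP.
- rewrite !commDl commxx addr0 (commC2 y x) => /eqP.
  rewrite addr_eq0 commN2 => /eqP dxE.
  have := cs (d + x); rewrite /= orbF => /or4P[]; rewrite commDl.
  + by rewrite commxx add0r commC2 (negbTE dx).
  + by rewrite commxx addr0 (negbTE dx).
  + by rewrite -dxE addrC -commDr (negbTE du).
  + by rewrite xu commDr dxE addrAC -mulr2n comm2 add0r (negbTE dy).
- rewrite !commDl commxx addr0 => /eqP; rewrite addr_eq0 commN2 => /eqP dyE.
  have := cs (d + y); rewrite /= orbF => /or4P[]; rewrite commDl.
  + by rewrite commxx add0r commC2 (negbTE dy).
  + by rewrite (commC2 y x) -dyE -commDr (negbTE du).
  + by rewrite commxx addr0 (negbTE dy).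
  + by rewrite yu commDr dyE -addrA -mulr2n comm2 addr0 (negbTE dx).
- by rewrite !commDl xu yu -addrA -mulr2n comm2 addr0 => /eqP; exact/negP.
Qed.

End TwoTorsion.

(** * Commutators of order 3 and generators modulo the center *)

Lemma exists_comm2_neq0 : exists x y, [~ x, y] *+ 2 != 0.
Proof.
case: (boolP [exists x, exists y, [~ x, y] *+ 2 != 0]).
  by case/existsP => x /existsP[y xy]; exists x, y.
rewrite negb_exists => /forallP h; case: two_torsion_absurd => x y.
by have := h x; rewrite negb_exists => /forallP/(_ y)/negPn/eqP.
Qed.

(* With a = [z, x], b = [z, y] and c = [x, y], [P a b] says that z commutes with
   x, y, x + y or x - y; the other hypotheses say so for z + y, z + x, z - x. *)
Lemma four_lines (V : zmodType) (a b c : V)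
    (P := fun a b : V => [|| a == 0, b == 0, a + b == 0 | a - b == 0]) :
    c *+ 3 = 0 -> c != 0 ->
    P a b -> P (a - c) b -> P a (b + c) -> P a (b - c) ->
  exists i j : 'I_3, a = c *+ j /\ b = - (c *+ i).
Proof.
move=> c3 c0; have c2 : c + c = - c.
  by apply/eqP; rewrite -addr_eq0 -mulr2n -mulrSr c3.
suff Q : P a b -> P (a - c) b -> P a (b + c) -> P a (b - c) ->
   a \in [:: 0; c; - c] /\ b \in [:: 0; c; - c].
  move=> p0 p1 p2 p3; have [] := Q p0 p1 p2 p3; rewrite !inE => Ha Hb.
  have [j aj] : exists j : 'I_3, a = c *+ j.
    case/or3P: Ha => /eqP ->.
    - by exists (inord 0); rewrite inordK.
    - by exists (inord 1); rewrite inordK.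
    (* The index 2 stands for [- c], since [c + c = - c]. *)
    - by exists (inord 2); rewrite inordK // mulr2n c2.
  have [i bi] : exists i : 'I_3, b = - (c *+ i).
    case/or3P: Hb => /eqP ->.
    - by exists (inord 0); rewrite inordK // mulr0n oppr0.
    - by exists (inord 2); rewrite inordK // mulr2n c2 opprK.
    - by exists (inord 1); rewrite inordK.
  by exists i, j.
have cN0 : - c != 0 by rewrite oppr_eq0.
have ccN : c != - c by apply: contraNneq cN0 => cN; rewrite -c2 {1}cN addNr.
rewrite {}/P !inE => p0 p1 p2 p3.
have [a0 | a0] := eqVneq a 0.
  move: p1; rewrite a0 add0r (negbTE cN0) /= => /or3P[/eqP->|bc|bc].
  - by rewrite eqxx.
  - by rewrite addrC subr_eq0 in bc; rewrite bc orbT.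
  - by rewrite -opprD oppr_eq0 addrC addr_eq0 in bc; rewrite bc !orbT.
have [b0 | b0] := eqVneq b 0.
  move: p2; rewrite b0 add0r (negbTE a0) (negbTE c0) /= addr_eq0 subr_eq0.
  by case/orP=> ->; rewrite ?orbT.
rewrite (negbTE a0) (negbTE b0) /= addr_eq0 subr_eq0 in p0.
rewrite (negbTE a0) /= in p2 p3.
(* With [a] and [b] nonzero, [p0] leaves [b = a] or [b = - a]. Substituting this, [p2] and [p3]
   become conditions on [a] and [c] alone. *)
have [e2 e3 bE] : [/\ a = c \/ a + a = c, a = - c \/ a + a = - c
    & b = a \/ b = - a].
  case/orP: p0 => /eqP ab.
    have bE : b = - a by rewrite ab opprK.
    rewrite bE !addrA subrr !add0r (negbTE c0) (negbTE cN0) /= in p2 p3.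
    split; last by right.
    + case/orP: p2; first by rewrite addrC subr_eq0 => /eqP; left.
      by rewrite opprD opprK addrA subr_eq0 => /eqP; right.
    + case/orP: p3; first by rewrite -opprD oppr_eq0 addr_eq0 => /eqP; left.
      by rewrite opprD !opprK addrA addr_eq0 => /eqP; right.
  rewrite -ab !opprD !opprK !addrA subrr !add0r in p2 p3.
  rewrite (negbTE c0) (negbTE cN0) !orbF in p2 p3.
  split; last by left.
  + by case/orP: p3; rewrite subr_eq0 => /eqP; auto.
  + by case/orP: p2; rewrite addr_eq0 => /eqP; auto.
(* Both doubled alternatives together would give [c = - c]. *)
have aE : a = c \/ a = - c.
  case: e2 e3 => [->|aac] [->|aac']; auto.
  by rewrite -aac' aac eqxx in ccN.
by case: bE aE => -> [] ->; rewrite ?opprK !eqxx !orbT.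
Qed.

(** The hypotheses say that [c] has additive order exactly 3. *)
Lemma eq_mulrn_mod3 (V : zmodType) (c : V) (m n : nat) :
  c *+ 3 = 0 -> c != 0 -> (c *+ m == c *+ n) = (m == n %[mod 3]).
Proof.
move=> c3 c0.
have mod3 k : c *+ k = c *+ (k %% 3).
  by rewrite {1}(divn_eq k 3) mulrnDr mulnC mulrnA c3 mul0rn add0r.
rewrite mod3 (mod3 n); have := ltn_pmod m (isT : 0 < 3)%N.
have := ltn_pmod n (isT : 0 < 3)%N.
have c2 : c *+ 2 != 0 by apply: contraNneq c0 => c2; rewrite -c3 mulrS c2 addr0.
have cc : c != c *+ 2.
  by rewrite mulr2n -subr_eq0 opprD addrA subrr add0r oppr_eq0.
move: (m %% 3)%N (n %% 3)%N => [|[|[|?]]] [|[|[|?]]] // _ _;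
  rewrite ?mulr1n ?mulr0n ?eqxx //; apply/negbTE => //;
  by rewrite eq_sym.
Qed.

(** These are the pairs of vectors over the field of 3 elements with zero determinant: the zero
    vector pairs with all 9, each of the 8 others with its 3 multiples, and 9 + 24 = 33. The proof
    evaluates the sum directly. *)
Lemma card_cross_mod3 :
  #|[set q : ('I_3 * 'I_3) * ('I_3 * 'I_3) |
       q.1.1 * q.2.2 == q.1.2 * q.2.1 %[mod 3]]| = 33.
Proof.
rewrite -sum1dep_card.
rewrite -(pair_big_dep xpredT
  (fun p q : 'I_3 * 'I_3 => p.1 * q.2 == p.2 * q.1 %[mod 3])
  (fun _ _ => 1%N)) /=.
under eq_bigr do rewrite big_mkcond /=.
rewrite -(pair_bigA _ (fun i j : 'I_3 =>
  \sum_(q : 'I_3 * 'I_3) if i * q.2 == j * q.1 %[mod 3] then 1%N else 0%N)) /=.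
under eq_bigr do under eq_bigr do
  rewrite -(pair_bigA _ (fun k l : 'I_3 =>
    if _ * l == _ * k %[mod 3] then 1%N else 0%N)) /=.
by rewrite !big_ord_recl !big_ord0.
Qed.

Lemma generators_mod_center : exists x y,
  [/\ [~ x, y] *+ 3 = 0, [~ x, y] != 0 &
      forall z, exists i j : 'I_3, central (z + x *+ i + y *+ j)].
Proof.
have [x [y xy2]] := exists_comm2_neq0; exists x, y; set c := [~ x, y] in xy2 *.
have c0 : c != 0 by apply: contraNneq xy2 => ->; rewrite mul0rn.
have yx : [~ y, x] = - c by rewrite commC.
have cN : - c != 0 by rewrite oppr_eq0.
have cc : c + c != 0 by rewrite -mulr2n.
(* The six commutators are [c] or [- c], except [[~ x + y, x - y] = - (c + c)]; this is where [xy2]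
   enters. *)
have [|||||| Us Ns] := @noncommuting_reps x y (x + y) (x - y);
  rewrite ?(commDl, commDr, commNr, commxx, yx, addr0, add0r, oppr0) //.
  by rewrite -opprD oppr_eq0.
have cs := comm_some_rep Us Ns erefl.
have ca := comm_all_reps_central Us Ns erefl.
(* The commutators of [x + y *+ 2] with the four representatives are [-2c], [c], [-c] and [-3c];
   only the last can vanish. *)
have c3 : c *+ 3 = 0.
  have := cs (x + y *+ 2).
  rewrite /= !(commDl, commDr, commNr, commMnl, commxx).
  rewrite -/c yx mul0rn !addr0 !add0r oppr0 ?addr0 orbF mulNrn.
  rewrite oppr_eq0 (negbTE xy2) (negbTE c0) mulr2n opprD addrA subrr add0r.
  by rewrite (negbTE cN) /= -!opprD oppr_eq0 -mulr2n -mulrS => /eqP.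
split=> // z.
have := @four_lines _ [~ z, x] [~ z, y] c c3 c0.
have H w : [|| [~ w, x] == 0, [~ w, y] == 0, [~ w, x] + [~ w, y] == 0
    | [~ w, x] - [~ w, y] == 0].
  by have := cs w; rewrite /= !commDr commNr orbF.
case; first exact: H.
- by have := H (z + y); rewrite !commDl yx commxx addr0.
- by have := H (z + x); rewrite !commDl commxx addr0.
- by have := H (z - x); rewrite !commDl !commNl commxx oppr0 addr0.
move=> i [j [zx zy]]; exists i, j; apply: ca.
rewrite /= !commDr !commNr !commDl !commMnl !commxx yx -/c zx zy !mul0rn mulNrn.
by rewrite !addr0 addNr subrr addr0 subr0 eqxx.
Qed.

(** * Counting commuting pairs *)

Local Notation Z := {z | central z}.

Lemma commuting_probability_5_centralizer :
  commuting_probability mul = 11%:R / 27%:R :> rat.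
Proof.
have [x [y [c3 c0 gen]]] := generators_mod_center.
set c := [~ x, y] in c3 c0.
(* A bijection onto [R], with signs opposite to those in [gen]. Commutators with [x] and [y] recover
   the two indices, whence injectivity. *)
pose f (q : ('I_3 * 'I_3) * Z) : R :=
  val q.2 - x *+ q.1.1 - y *+ q.1.2.
have yx : [~ y, x] = - c by rewrite commC.
have fx q : [~ f q, x] = c *+ q.1.2.
  rewrite /f !commDl !commNl !commMnl commxx yx (centralP _ (valP q.2)).
  by rewrite mul0rn subrr add0r mulNrn opprK.
have fy q : [~ f q, y] = - (c *+ q.1.1).
  rewrite /f !commDl !commNl !commMnl commxx (centralP _ (valP q.2)).
  by rewrite mul0rn subr0 add0r.
have ord3 (i j : 'I_3) : c *+ i = c *+ j -> i = j.
  move/eqP; rewrite eq_mulrn_mod3 // !modn_small ?ltn_ord //.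
  by move/eqP/val_inj.
have f_inj : injective f.
  move=> q q' E; have := fx q; rewrite E fx => /ord3 E2.
  have := fy q; rewrite E fy => /oppr_inj/ord3 E1.
  case: q q' E E1 E2 => [[i j] z] [[i' j'] z'] E /= E1 E2.
  by move: E; rewrite /f /= E1 E2 => /addIr/addIr/val_inj ->.
have f_surj r : exists q, r = f q.
  have [i [j cz]] := gen r; exists ((i, j), exist (fun z => central z) _ cz).
  by rewrite /f /= addrAC addrK addrK.
(* Writing [(i, j)] and [(i', j')] for the indices, the commutator is [c] times the determinant
   [i j' - j i']; the central parts drop out. *)
have ff q q' : (mul (f q) (f q') == mul (f q') (f q)) =
   (q.1.1 * q'.1.2 == q.1.2 * q'.1.1 %[mod 3])%N.
  rewrite -subr_eq0 -[_ - _]/(commutator _ _) {2}/f.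
  rewrite !commDr !commNr !commMnr fx fy.
  rewrite commC (centralP _ (valP q'.2)) oppr0 add0r mulNrn opprK -!mulrnA.
  by rewrite addrC subr_eq0 eq_mulrn_mod3.
(* Regroups indices and central parts, so that the commuting pairs become a product of 33 index
   pairs with all of [Z * Z]. The ratio is then 33/81. *)
pose h (p : (('I_3 * 'I_3) * ('I_3 * 'I_3)) * (Z * Z)) :=
  (f (p.1.1, p.2.1), f (p.1.2, p.2.2)).
have h_inj : injective h.
  by move=> [[? ?] [? ?]] [[? ?] [? ?]] [] /f_inj[-> ->] /f_inj[-> ->].
have cardR : #|R| = (9 * #|{: Z}|)%N.
  have <- : #|codom f| = #|R|.
    by apply: eq_card => r; have [q ->] := f_surj r; rewrite codom_f.
  by rewrite card_codom // !card_prod card_ord.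
have cardZ : #|{: Z}| != 0%N.
  apply/eqP => Z0; have /card0_eq/(_ (0 : R)) // : #|R| = 0%N.
  by rewrite cardR Z0.
rewrite /commuting_probability.
have -> : [set p : R * R | mul p.1 p.2 == mul p.2 p.1] =
    h @: setX [set q : ('I_3 * 'I_3) * ('I_3 * 'I_3) |
       q.1.1 * q.2.2 == q.1.2 * q.2.1 %[mod 3]]%N setT.
  apply/setP => -[r r']; have [[q z] ->] := f_surj r.
  have [[q' z'] ->] := f_surj r'; rewrite inE ff.
  by rewrite (mem_imset _ ((q, q'), (z, z')) h_inj) !inE andbT.
rewrite card_imset // cardsX cardsT card_prod card_cross_mod3 cardR.
have Z0 : (#|{: Z}|%:R : rat) != 0 by rewrite pnatr_eq0.
rewrite !natrM; move: (#|{: Z}|%:R : rat) Z0 => k k0.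
by rewrite exprMn -expr2 -mulf_div divff ?expf_neq0 // mulr1; apply/eqP.
Qed.

End Commutator.

Theorem theorem3p2 (R : finZmodType) (mul : R -> R -> R)
    (rngR : is_rng mul) (cent5 : n_centralizer 5 mul) :
  commuting_probability mul = 11%:R / 27%:R :> rat.
Proof. exact: commuting_probability_5_centralizer. Qed.
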